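(* The smooth mapping $\tilde\nu:\mathbb RP^{n\,\vee}\setminus\{\infty\}\to\tilde{\mathcal T}^n$ is a diffeomorphism.
   Context: $\mathbb RP^{n\,\vee}$ is the dual projective space of lines through the origin in the dual space $(\mathbb R^{n+1})^*$; $\langle(y_1,\dots,y_{n+1})\rangle$ denotes the line spanned by the linear form with coefficients $y_i$, and $\infty=\langle(0,\dots,0,1)\rangle$. With $\boldsymbol\epsilon=(1,1)$, $\mathcal T^n=\{(\mathbf n,c\boldsymbol\epsilon)=(\mathbf n,c,c):\mathbf n\in S^{n-1},c\in\mathbb R\}\subset\mathbb R^{n+2}$, and $\tilde{\mathcal T}^n=\mathcal T^n/\!\sim$ is the quotient manifold by the identification $z\sim-z$. For $\langle(y_1,\dots,y_{n+1})\rangle\neq\infty$ put $(y_1',\dots,y_{n+1}')=\bigl(\sum_{i=1}^ny_i^2\bigr)^{-1/2}(y_1,\dots,y_{n+1})$ and $\mathbf n_y=(y_1',\dots,y_n')$; then $\tilde\nu(\langle(y_1,\dots,y_{n+1})\rangle)$ is the class of $(\mathbf n_y,-y_{n+1}'\boldsymbol\epsilon)$ in $\tilde{\mathcal T}^n$. *)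

(* Defs.v *)
From HB Require Import structures.
From mathcomp Require Import all_boot all_order all_algebra.
From mathcomp Require Import mathcomp_extra boolp classical_sets functions.
From mathcomp Require Import cardinality reals topology normedtype derive realfun.
From mathcomp Require Import ring lra.
Set Implicit Arguments.
Unset Strict Implicit.
Unset Printing Implicit Defensive.
Import Order.TTheory GRing.Theory Num.Theory.
Import numFieldNormedType.Exports.
Local Open Scope classical_set_scope.
Local Open Scope ring_scope.

Section SmoothCalculus.
Context {R : realType} {m : nat}.
Implicit Types (U : set 'rV[R]_m) (f g : 'rV[R]_m -> R).

(** Class [C^k] on the open set [U]; [v] ranges over all directions, not only
    over the coordinate axes. *)
Fixpoint Ck (k : nat) U f : Prop :=
  match k with
  | 0 => forall x, U x -> {for x, continuous f}
  | k'.+1 => (forall x, U x -> {for x, continuous f}) /\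
      forall v, (forall x, U x -> derivable f x v) /\ Ck k' U (fun x => 'D_v f x)
  end.

Lemma Ck_cont k U f : Ck k U f -> forall x, U x -> {for x, continuous f}.
Proof. by case: k => [//|k] []. Qed.

Lemma CkW k U f : Ck k.+1 U f -> Ck k U f.
Proof.
elim: k f => [|k IH] f; first by case.
by case=> cf df; split=> // v; have [d1 d2] := df v; split=> //; exact: IH.
Qed.

Lemma Ck_sub k U V f : V `<=` U -> Ck k U f -> Ck k V f.
Proof.
move=> VU; elim: k f => [|k IH] f; first by move=> cf x /VU /cf.
case=> cf df; split=> [x /VU /cf //|v]; have [d1 d2] := df v.
by split=> [x /VU /d1 //|]; exact: IH.
Qed.

Lemma Ck_ext k U f g : open U -> (forall x, U x -> f x = g x) ->
  Ck k U f -> Ck k U g.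
Proof.
move=> oU; elim: k f g => [|k IH] f g fg;
  have nfg_ x : U x -> {near x, f =1 g}
    by [move=> Ux; apply: (filterS fg); exact: open_nbhs_nbhs].
  move=> cf x Ux; have nfg := nfg_ x Ux.
  rewrite /prop_for /continuous_at -(fg _ Ux); apply: cvg_trans (cf _ Ux).
  exact: (near_eq_cvg nfg).
case=> cf df; split.
  move=> x Ux; have nfg := nfg_ x Ux.
  rewrite /prop_for /continuous_at -(fg _ Ux); apply: cvg_trans (cf _ Ux).
  exact: (near_eq_cvg nfg).
move=> v; have [d1 d2] := df v; split.
  move=> x Ux; have nfg := nfg_ x Ux.
  exact: near_eq_derivable nfg (d1 _ Ux).
apply: IH d2 => x Ux; apply: near_eq_derive.
exact: nfg_.
Qed.

Lemma Ck_cst k U (a : R) : Ck k U (fun=> a).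
Proof.
elim: k a => [|k IH] a; first by move=> x _; exact: cst_continuous.
split=> [x _|v]; first exact: cst_continuous.
split=> [x _|]; first exact: derivable_cst.
have -> : (fun x => 'D_v (fun=> a) x) = (fun=> 0).
  by apply/funext => x; exact: derive_cst.
exact: IH.
Qed.

Lemma Ck_coord k U j : Ck k U (fun u => u ord0 j).
Proof.
have ic x v : is_derive x v (fun u : 'rV[R]_m => u ord0 j) (v ord0 j).
  have d := differentiable_coord x ord0 j.
  apply: DeriveDef; first exact: diff_derivable.
  rewrite deriveE //.
  have @f : {linear 'rV[R]_m -> R}.
    by exists (fun N : 'rV[R]_m => N ord0 j); do 2![eexists];
      do ?[constructor]; rewrite ?mxE// => ? *; rewrite ?mxE//;
      move=> ?; rewrite !mxE.
  rewrite (_ : (fun u : 'rV[R]_m => u ord0 j) = f) // diff_lin //.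
  exact: coord_continuous.
case: k => [|k]; first by move=> x _; exact: coord_continuous.
split=> [x _|v]; first exact: coord_continuous.
split=> [x _|]; first by have [] := ic x v.
have -> : (fun x => 'D_v (fun u : 'rV[R]_m => u ord0 j) x) = (fun=> v ord0 j).
  by apply/funext => x; have [_ ->] := ic x v.
exact: Ck_cst.
Qed.

Lemma Ck_add k U f g : open U ->
  Ck k U f -> Ck k U g -> Ck k U (fun x => f x + g x).
Proof.
move=> oU; elim: k f g => [|k IH] f g.
  by move=> cf cg x Ux; exact: (cvgD (cf _ Ux) (cg _ Ux)).
case=> cf df [cg dg]; split=> [x Ux|v]; first by exact: (cvgD (cf _ Ux) (cg _ Ux)).
have [f1 f2] := df v; have [g1 g2] := dg v.
split=> [x Ux|]; first by exact: (derivableD (f1 _ Ux) (g1 _ Ux)).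
apply: Ck_ext (IH _ _ f2 g2) => // x Ux.
by rewrite (deriveD (f1 _ Ux) (g1 _ Ux)).
Qed.

Lemma Ck_mul k U f g : open U ->
  Ck k U f -> Ck k U g -> Ck k U (fun x => f x * g x).
Proof.
move=> oU; elim: k f g => [|k IH] f g.
  by move=> cf cg x Ux; exact: (cvgM (cf _ Ux) (cg _ Ux)).
move=> Cf Cg; case: (Cf) => cf df; case: (Cg) => cg dg.
split=> [x Ux|v]; first by exact: (cvgM (cf _ Ux) (cg _ Ux)).
have [f1 f2] := df v; have [g1 g2] := dg v.
split=> [x Ux|]; first by exact: (derivableM (f1 _ Ux) (g1 _ Ux)).
apply: Ck_ext (Ck_add oU (IH _ _ (CkW Cf) g2) (IH _ _ (CkW Cg) f2)) => // x Ux.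
by rewrite (deriveM (f1 _ Ux) (g1 _ Ux)).
Qed.

Lemma Ck_opp k U f : open U -> Ck k U f -> Ck k U (fun x => - f x).
Proof.
move=> oU Cf; apply: Ck_ext (Ck_mul oU (Ck_cst k U (-1)) Cf) => // x _.
by rewrite mulN1r.
Qed.

Lemma Ck_sum (I : Type) (r : seq I) (P : pred I) k U (F : I -> 'rV[R]_m -> R) :
  open U -> (forall i, Ck k U (F i)) ->
  Ck k U (fun x => \sum_(i <- r | P i) F i x).
Proof.
move=> oU CF; elim: r => [|i r IH].
  by apply: Ck_ext (Ck_cst k U 0) => // x _; rewrite big_nil.
have [Pi|nPi] := boolP (P i).
  by apply: Ck_ext (Ck_add oU (CF i) IH) => // x _; rewrite big_cons Pi.
by apply: Ck_ext IH => // x _; rewrite big_cons (negPf nPi).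
Qed.

Lemma Ck_inv k U f : open U -> (forall x, U x -> f x != 0) ->
  Ck k U f -> Ck k U (fun x => (f x)^-1).
Proof.
move=> oU f0; elim: k f f0 => [|k IH] f f0.
  by move=> cf x Ux; exact: (cvgV (f0 _ Ux) (cf _ Ux)).
move=> Cf; case: (Cf) => cf df.
split=> [x Ux|v]; first by exact: (cvgV (f0 _ Ux) (cf _ Ux)).
have [f1 f2] := df v.
split=> [x Ux|]; first by exact: (derivableV (f0 _ Ux) (f1 _ Ux)).
have Ci := IH _ f0 (CkW Cf).
apply: Ck_ext (Ck_opp oU (Ck_mul oU (Ck_mul oU Ci Ci) f2)) => // x Ux.
rewrite (deriveV (f0 _ Ux) (f1 _ Ux)) /= /GRing.scale /=.
by rewrite expr2 invfM mulNr.
Qed.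

Lemma Ck_sqrt k U f : open U -> (forall x, U x -> 0 < f x) ->
  Ck k U f -> Ck k U (fun x => Num.sqrt (f x)).
Proof.
move=> oU f0.
have cs x : U x -> {for x, continuous f} ->
    {for x, continuous (fun x => Num.sqrt (f x))}.
  by move=> Ux cf; apply: continuous_comp => //; exact: sqrt_continuous.
elim: k f f0 cs => [|k IH] f f0 cs.
  by move=> cf x Ux; apply: cs => //; exact: cf.
move=> Cf; case: (Cf) => cf df.
split=> [x Ux|v]; first by apply: cs => //; exact: cf.
have [f1 f2] := df v.
have ds x : U x -> is_derive x v (fun x => Num.sqrt (f x))
    ('D_v f x * (2 * Num.sqrt (f x))^-1).
  move=> Ux; have d := f1 _ Ux.
  have d1 : is_derive (0 : R) 1 (fun h : R => f (h *: v + x)) ('D_v f x).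
    apply: DeriveDef; first exact: ((derivable1P f x v).1 d).
    by rewrite /derive /=; under eq_fun do rewrite addr0 scale0r add0r [_%:A]mulr1.
  have fx0 : 0 < f (0 *: v + x) by rewrite scale0r add0r f0.
  have d2 := is_derive1_comp (is_derive1_sqrt fx0) d1.
  rewrite scale0r add0r in d2.
  apply: DeriveDef; first by case: d2 => d2 _; exact: ((derivable1P _ x v).2 d2).
  rewrite [RHS]mulrC; have [_ <-] := d2.
  by rewrite /derive /=; under [in RHS]eq_fun do
    rewrite addr0 scale0r add0r [_%:A]mulr1.
split=> [x Ux|]; first by have [] := ds x Ux.
have C2 : Ck k U (fun x => (2 * Num.sqrt (f x))^-1).
  apply: Ck_inv => //.
    by move=> x Ux; rewrite mulf_neq0 // gt_eqF // sqrtr_gt0 f0.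
  by apply: Ck_mul => //; [exact: Ck_cst|apply: IH => //; exact: CkW].
apply: Ck_ext (Ck_mul oU f2 C2) => // x Ux.
by have [_ ->] := ds x Ux.
Qed.

End SmoothCalculus.

(** Smooth manifolds, presented by a countable atlas of injective
    parametrizations [x : dom x -> M] of a set [M] of points.  The topology of
    [M] is the one for which all parametrizations are open embeddings. *)

Record param (R : realType) (d : nat) (P : Type) :=
  Param { dom : set 'rV[R]_d ; pmap :> 'rV[R]_d -> P }.

Section Atlas.
Context {R : realType}.

Definition patch {d P} (x : param R d P) : set P := x @` dom x.

Definition smooth_on {d e} (O : set 'rV[R]_d) (g : 'rV[R]_d -> 'rV[R]_e) :=
  forall k j, Ck k O (fun u => g u ord0 j).

(** [y^-1 \o f \o x] is defined on an open set and is smooth there; the map [g]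
    is determined on this set by the injectivity of [y]. *)
Definition smooth_in {d e P Q} (x : param R d P) (y : param R e Q) (f : P -> Q) :=
  let O := dom x `&` [set u | patch y (f (x u))] in
  open O /\ exists2 g : 'rV[R]_d -> 'rV[R]_e, smooth_on O g &
    forall u, O u -> dom y (g u) /\ y (g u) = f (x u).

Definition atlas_open {d P} (A : set (param R d P)) (O : set P) :=
  forall x, A x -> open (dom x `&` [set u | O (x u)]).

Record smooth_atlas {d P} (M : set P) (A : set (param R d P)) : Prop :=
  SmoothAtlas {
    atlas_countable : countable A;
    atlas_dom : forall x, A x -> open (dom x);
    atlas_sub : forall x, A x -> patch x `<=` M;
    atlas_inj : forall x, A x -> {in dom x &, injective x};
    atlas_cover : M `<=` \bigcup_(x in A) patch x;
    atlas_trans : forall x y, A x -> A y -> smooth_in x y id;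
    atlas_hausdorff : forall p q, M p -> M q -> p <> q ->
      exists O1 O2 : set P, [/\ atlas_open A O1, atlas_open A O2,
        O1 p, O2 q & M `&` O1 `&` O2 = set0] }.

Record manifold (d : nat) := Manifold {
  point : Type;
  carrier : set point;
  atlas : set (param R d point);
  manifold_atlas : smooth_atlas carrier atlas }.
Arguments carrier {d} m _.
Arguments atlas {d} m _.

Definition smooth_map {d e} (M : manifold d) (N : manifold e)
    (f : point M -> point N) :=
  (forall p, carrier M p -> carrier N (f p)) /\
  forall x y, atlas M x -> atlas N y -> smooth_in x y f.
Arguments smooth_map {d e} M N f.

Definition diffeomorphism {d e} (M : manifold d) (N : manifold e)
    (f : point M -> point N) :=
  smooth_map M N f /\
  exists g : point N -> point M, [/\ smooth_map N M g,
    forall p, carrier M p -> g (f p) = p &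
    forall q, carrier N q -> f (g q) = q].
Arguments diffeomorphism {d e} M N f.

Lemma open_pre {d} (U : set 'rV[R]_d) (f : 'rV[R]_d -> R) (B : set R) :
  open U -> open B -> (forall x, U x -> {for x, continuous f}) ->
  open (U `&` [set u | B (f u)]).
Proof.
move=> oU oB cf; rewrite openE => x [Ux Bx].
apply: filterI; first by exact: (open_nbhs_nbhs (conj oU Ux)).
have : nbhs (f x) B by apply: open_nbhs_nbhs; split.
exact: (cf _ Ux).
Qed.

Lemma open_neq0 {d} (U : set 'rV[R]_d) (f : 'rV[R]_d -> R) :
  open U -> (forall x, U x -> {for x, continuous f}) ->
  open (U `&` [set u | f u != 0]).
Proof. by move=> oU; exact: (open_pre oU (@open_neq _ 0)). Qed.

Lemma hausdorff_sep {d P} (M : set P) (A : set (param R d P)) p q :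
  (forall x, A x -> open (dom x)) ->
  (exists2 h : P -> R, h p != h q &
    forall x, A x -> forall u, dom x u -> {for u, continuous (h \o x)}) ->
  exists O1 O2 : set P, [/\ atlas_open A O1, atlas_open A O2,
    O1 p, O2 q & M `&` O1 `&` O2 = set0].
Proof.
move=> oA [h].
wlog hpq : p q / h p < h q => [W|] npq ch.
  have [pq|qp|/eqP] := ltgtP (h p) (h q); last by rewrite (negPf npq).
    exact: W.
  have [||O1 [O2 [a b c e D]]] := W q p qp; rewrite 1?eq_sym //.
  by exists O2, O1; split=> //; rewrite -setIA (setIC O2) setIA.
pose m := (h p + h q) / 2.
exists [set r | h r < m], [set r | m < h r]; split.
- move=> x Ax; apply: (@open_pre _ _ (h \o x) [set r | r < m]) (ch x Ax);
    [exact: oA|exact: open_lt].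
- move=> x Ax; apply: (@open_pre _ _ (h \o x) [set r | m < r]) (ch x Ax);
    [exact: oA|exact: open_gt].
- by rewrite /= /m; lra.
- by rewrite /= /m; lra.
- by apply/seteqP; split=> // r [[_ /= h1] h2]; have := lt_trans h1 h2;
    rewrite ltxx.
Qed.

Lemma smooth_row {d e} (O : set 'rV[R]_d) (F : 'I_e -> 'rV[R]_d -> R) :
  (forall k j, Ck k O (F j)) -> smooth_on O (fun u => \row_j F j u).
Proof.
move=> CF k j; have -> : (fun u => (\row_j F j u) ord0 j) = F j.
  by apply/funext => u; rewrite mxE.
exact: CF.
Qed.

Definition restrict {d P} (O : set P) (x : param R d P) : param R d P :=
  Param (dom x `&` [set u | O (x u)]) x.

Lemma restrict_atlas {d P} (M : set P) (A : set (param R d P)) (O : set P) :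
  smooth_atlas M A -> atlas_open A O -> smooth_atlas (M `&` O) (restrict O @` A).
Proof.
move=> MA oO; split.
- exact/(sub_countable (card_image_le _ _))/(atlas_countable MA).
- by move=> _ [x Ax <-]; exact: oO.
- move=> _ [x Ax <-] _ [u [du Ou] <-]; split=> //.
  by apply: (atlas_sub MA Ax); exists u.
- move=> _ [x Ax <-] u v; rewrite !inE => -[du _] [dv _].
  by apply: (atlas_inj MA Ax); rewrite inE.
- move=> p [/(atlas_cover MA) [x Ax [u du xu]] Op].
  exists (restrict O x); first by exists x.
  by exists u => //; split=> //=; rewrite xu.
- move=> _ _ [x Ax <-] [y Ay <-]; have [oxy [g sg gP]] := atlas_trans MA Ax Ay.
  have E : dom (restrict O x) `&` [set u | patch (restrict O y) (x u)] =
      (dom x `&` [set u | patch y (x u)]) `&` (dom x `&` [set u | O (x u)]).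
    apply/seteqP; split=> u.
      by move=> [[du Ou] [v [dv Ov] yv]]; split; split=> //; exists v.
    move=> [[du [v dv yv]] [_ Ou]]; split=> //; exists v => //.
    by split=> //=; rewrite yv.
  rewrite /smooth_in /= E; split; first by apply: openI => //; exact: oO.
  exists g; first by move=> k j; apply: Ck_sub (sg k j); exact: subIsetl.
  move=> u [[du Ou] [v [dv Ov] yv]].
  have [|dg yg] := gP u; first by split=> //; exists v.
  by split=> //; split=> //=; rewrite yg.
- move=> p q [Mp _] [Mq _] /(atlas_hausdorff MA Mp Mq) [O1 [O2 [o1 o2 p1 q2 D]]].
  have oR O' : atlas_open A O' -> atlas_open (restrict O @` A) O'.
    move=> oO' _ [x Ax <-]; rewrite /= (_ : _ `&` _ =
      (dom x `&` [set u | O (x u)]) `&` (dom x `&` [set u | O' (x u)])).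
      by apply: openI; [exact: oO|exact: oO'].
    by apply/seteqP; split=> u /=; tauto.
  exists O1, O2; split=> //; [exact: oR|exact: oR|].
  apply/seteqP; split=> // r [[[Mr _] r1] r2].
  by have : (M `&` O1 `&` O2) r by []; rewrite D.
Qed.

(** The points of the open submanifold are those of [carrier M] in [O]; the
    type of points is unchanged. *)
Definition open_submanifold {d} (M : manifold d) (O : set (point M))
    (oO : atlas_open (atlas M) O) : manifold d :=
  Manifold (restrict_atlas (manifold_atlas M) oO).

(** The atlas of a quotient [pi : M -> M/~] under which [pi] is a local
    diffeomorphism. *)
Definition quotient_atlas {d P Q} (pi : P -> Q) (A : set (param R d P)) :
    set (param R d Q) :=
  [set Param (dom x) (pi \o x) | x in
    [set x | A x /\ {in dom x &, injective (pi \o x)}]].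

End Atlas.
Arguments carrier {R d} m _.
Arguments atlas {R d} m _.
Arguments manifold R d : clear implicits.
Arguments smooth_map {R d e} M N f.
Arguments diffeomorphism {R d e} M N f.

Section ProjectiveSpace.
Context {R : realType}.

(** The linear form on [R^(n+1)] with coefficients [y], and its span. *)
Definition linform {n} (y : 'rV[R]_n.+1) : 'Hom('rV[R]_n.+1, R^o) :=
  linfun (fun x : 'rV[R]_n.+1 => \sum_i y ord0 i * x ord0 i : R^o).

Definition line {n} (y : 'rV[R]_n.+1) : {vspace 'Hom('rV[R]_n.+1, R^o)} :=
  <[linform y]>%VS.

Definition infinity n : {vspace 'Hom('rV[R]_n.+1, R^o)} :=
  line (delta_mx ord0 ord_max).

Definition coefs {n} (l : 'Hom('rV[R]_n.+1, R^o)) : 'rV[R]_n.+1 :=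
  \row_i l (delta_mx ord0 i).

Definition insert1 {n} (i : 'I_n.+1) (u : 'rV[R]_n) : 'rV[R]_n.+1 :=
  \row_j (if unlift i j is Some k then u ord0 k else 1).

Definition proj_param {n} (i : 'I_n.+1) :
    param R n {vspace 'Hom('rV[R]_n.+1, R^o)} :=
  Param setT (fun u => line (insert1 i u)).

Lemma linformE n (y x : 'rV[R]_n.+1) :
  linform y x = \sum_i y ord0 i * x ord0 i.
Proof.
have lin : linear (fun x : 'rV[R]_n.+1 => \sum_i y ord0 i * x ord0 i : R^o).
  move=> a u v; rewrite scaler_sumr -big_split /=; apply: eq_bigr => i _.
  by rewrite !mxE mulrDr mulrCA.
pose f : {linear 'rV[R]_n.+1 -> R^o} :=
  HB.pack (fun x : 'rV[R]_n.+1 => \sum_i y ord0 i * x ord0 i : R^o)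
    (GRing.isLinear.Build _ _ _ _ _ lin).
exact: (lfunE f).
Qed.

Lemma linformK n : cancel (@linform n) coefs.
Proof.
move=> y; apply/rowP => i; rewrite mxE linformE (bigD1 i) //= big1 ?addr0.
  by rewrite mxE !eqxx mulr1.
by move=> j ji; rewrite mxE (negPf ji) andbF mulr0.
Qed.

Lemma coefsK n : cancel (@coefs n) linform.
Proof.
move=> l; apply/lfunP => x; rewrite linformE [in RHS](row_sum_delta x) linear_sum.
by apply: eq_bigr => i _; rewrite linearZ /= mxE mulrC.
Qed.

Lemma linformZ n (c : R) (y : 'rV[R]_n.+1) : linform (c *: y) = c *: linform y.
Proof.
apply/lfunP => x; rewrite scale_lfunE !linformE scaler_sumr.
by apply: eq_bigr => i _; rewrite mxE -mulrA.
Qed.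

Lemma linform_eq0 n (y : 'rV[R]_n.+1) : (linform y == 0) = (y == 0).
Proof.
apply/eqP/eqP => [y0|->].
  by rewrite -[y]linformK y0; apply/rowP => i; rewrite !mxE lfunE.
by rewrite -(scale0r 0) linformZ scale0r.
Qed.

Lemma lineP n (y z : 'rV[R]_n.+1) :
  line y = line z <-> exists2 c, c != 0 & y = c *: z.
Proof.
split=> [E|[c c0 ->]].
  have : linform y \in line z by rewrite -E memv_line.
  move=> /vlineP [c]; rewrite -linformZ => /(can_inj (@linformK n)) yz.
  have [c0|c0] := eqVneq c 0; last by exists c.
  have y0 : y = 0 by rewrite yz c0 scale0r.
  have : linform z \in line y by rewrite E memv_line.
  move=> /vlineP [e]; rewrite -linformZ => /(can_inj (@linformK n)) zy.
  by exists 1; rewrite ?oner_neq0 // zy y0 !scaler0.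
apply/eqP; rewrite eqEsubv; apply/andP; split; apply/subvP => v /vlineP [k ->].
  by apply/vlineP; exists (k * c); rewrite linformZ scalerA.
by apply/vlineP; exists (k / c); rewrite linformZ scalerA divfK.
Qed.

Lemma dim_line n (y : 'rV[R]_n.+1) : (\dim (line y) = 1)%N <-> y <> 0.
Proof.
rewrite /line dim_vline linform_eq0.
by case: eqP => y0; split.
Qed.

Lemma line_pick n (L : {vspace 'Hom('rV[R]_n.+1, R^o)}) : (\dim L = 1)%N ->
  L = line (coefs (vpick L)) /\ coefs (vpick L) != 0.
Proof.
move=> L1; have p0 : vpick L != 0 by rewrite vpick0 -dimv_eq0 L1.
split; last by rewrite -linform_eq0 coefsK.
apply/esym/eqP; rewrite /line coefsK eqEdim L1 dim_vline p0 andbT.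
by rewrite -memvE memv_pick.
Qed.

Lemma line_pickE n (y : 'rV[R]_n.+1) : y != 0 ->
  exists2 c, c != 0 & coefs (vpick (line y)) = c *: y.
Proof.
move=> y0; apply/lineP/esym.
by have /dim_line/line_pick [] := elimN eqP y0.
Qed.

Lemma insert1_lift n (i : 'I_n.+1) u k : insert1 i u ord0 (lift i k) = u ord0 k.
Proof. by rewrite mxE liftK. Qed.

Lemma insert1_id n (i : 'I_n.+1) u : insert1 i u ord0 i = 1.
Proof. by rewrite mxE unlift_none. Qed.

Lemma insert1_neq0 n (i : 'I_n.+1) u : insert1 i u != 0.
Proof.
apply/eqP => /rowP /(_ i); rewrite insert1_id mxE => /eqP.
by rewrite oner_eq0.
Qed.

Lemma Ck_insert1 n (i j : 'I_n.+1) k O : Ck k O (fun u => insert1 i u ord0 j).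
Proof.
rewrite (_ : (fun u => _) =
  (fun u : 'rV_n => if unlift i j is Some l then u ord0 l else 1)).
  by case: unliftP => [l _|_]; [exact: Ck_coord|exact: Ck_cst].
by apply/funext => u; rewrite mxE.
Qed.

Lemma patch_line n (i : 'I_n.+1) (y : 'rV[R]_n.+1) : y ord0 i != 0 ->
  line (insert1 i (\row_k (y ord0 (lift i k) / y ord0 i))) = line y.
Proof.
move=> yi; apply/lineP; exists (y ord0 i)^-1; first by rewrite invr_eq0.
apply/rowP => j; rewrite !mxE; case: unliftP => [k ->|->].
  by rewrite mxE mulrC.
by rewrite mulVf.
Qed.

Lemma proj_patchP n (i : 'I_n.+1) (y : 'rV[R]_n.+1) :
  patch (proj_param i) (line y) <-> y ord0 i != 0.
Proof.
split=> [[u _ /esym/lineP [c c0 ->]]|yi].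
  by rewrite mxE insert1_id mulr1.
by eexists; last exact: patch_line yi.
Qed.

Definition dotp {n} (x y : 'rV[R]_n) : R := \sum_i x ord0 i * y ord0 i.

Lemma dotp_ge0 n (x : 'rV[R]_n) : 0 <= dotp x x.
Proof. by apply: sumr_ge0 => i _; rewrite -expr2 sqr_ge0. Qed.

Lemma dotp_eq0 n (x : 'rV[R]_n) : (dotp x x == 0) = (x == 0).
Proof.
apply/eqP/eqP => [|->]; last by apply: big1 => i _; rewrite mxE mul0r.
move=> /eqP; rewrite psumr_eq0 => [/allP H|i _]; last by rewrite -expr2 sqr_ge0.
apply/rowP => i; rewrite mxE; apply/eqP.
by have := H i (mem_index_enum i); rewrite mulf_eq0 orbb.
Qed.

Lemma dotpC n (x y : 'rV[R]_n) : dotp x y = dotp y x.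
Proof. by apply: eq_bigr => i _; rewrite mulrC. Qed.

Lemma dotpZr n c (x y : 'rV[R]_n) : dotp x (c *: y) = c * dotp x y.
Proof. by rewrite mulr_sumr; apply: eq_bigr => i _; rewrite mxE mulrCA. Qed.

Lemma dotpZl n c (x y : 'rV[R]_n) : dotp (c *: x) y = c * dotp x y.
Proof. by rewrite dotpC dotpZr dotpC. Qed.

Lemma dotpDr n (x y z : 'rV[R]_n) : dotp x (y + z) = dotp x y + dotp x z.
Proof. by rewrite -big_split; apply: eq_bigr => i _; rewrite mxE mulrDr. Qed.

Lemma dotpDl n (x y z : 'rV[R]_n) : dotp (x + y) z = dotp x z + dotp y z.
Proof. by rewrite dotpC dotpDr !(dotpC z). Qed.

Lemma dotp_colinear n (x y : 'rV[R]_n) : x != 0 ->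
  dotp x y ^+ 2 / dotp y y = dotp x x -> exists c, y = c *: x.
Proof.
move=> x0 E; have xx : dotp x x != 0 by rewrite dotp_eq0.
have yy : dotp y y != 0.
  by apply: contra_neq xx => yy; rewrite -E yy invr0 mulr0.
exists (dotp x y / dotp x x); apply/eqP; rewrite -subr_eq0 -dotp_eq0.
rewrite -scaleNr dotpDl !dotpDr !dotpZl !dotpZr (dotpC y x).
have E' : dotp x y ^+ 2 = dotp x x * dotp y y by rewrite -E divfK.
apply/eqP; set a := dotp x y in E' *.
have -> : dotp y y = a ^+ 2 / dotp x x by rewrite E' mulrC mulKf.
by field.
Qed.

Lemma proj_atlas n :
  smooth_atlas [set L : {vspace 'Hom('rV[R]_n.+1, R^o)} | (\dim L = 1)%N]
    (range (@proj_param n)).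
Proof.
split.
- exact/(sub_countable (card_image_le _ _))/countableP.
- by move=> _ [i _ <-]; exact: openT.
- move=> _ [i _ <-] _ [u _ <-]; apply/dim_line/eqP; exact: insert1_neq0.
- move=> _ [i _ <-] u v _ _ /lineP [c _ E].
  have c1 : c = 1.
    by move/rowP: (E) => /(_ i); rewrite [RHS]mxE !insert1_id mulr1.
  apply/rowP => k; move/rowP: E => /(_ (lift i k)).
  by rewrite [RHS]mxE !insert1_lift c1 mul1r.
- move=> L /line_pick []; move: (coefs _) => y -> /eqP y0.
  have [i yi] : exists i, y ord0 i != 0.
    apply: contrapT => H; apply: y0; apply/rowP => i; rewrite [RHS]mxE.
    by apply/eqP; apply: contrapT => /negP yi; apply: H; exists i.
  exists (proj_param i); first by exists i.
  exact: ((proj_patchP i y).2 yi).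
- move=> _ _ [i _ <-] [j _ <-].
  rewrite /smooth_in.
  have E : dom (proj_param i) `&` [set u | patch (proj_param j) (proj_param i u)]
      = setT `&` [set u | insert1 i u ord0 j != 0].
    by apply/seteqP; split=> u [_ /proj_patchP].
  have oE : open (setT `&` [set u | insert1 i u ord0 j != 0]).
    apply: open_neq0; first exact: openT.
    exact: (@Ck_cont _ _ 0 _ _ (@Ck_insert1 n i j 0 setT)).
  rewrite /= in E *; rewrite E; split=> //.
  exists (fun u => \row_k (insert1 i u ord0 (lift j k) / insert1 i u ord0 j)).
    apply: smooth_row => k l; apply: Ck_mul => //; first exact: Ck_insert1.
    apply: (@Ck_inv _ _ _ _ (fun u => insert1 i u ord0 j)) => //.
      by move=> u [].
    exact: Ck_insert1.
  by move=> u [_ /proj_patchP uj]; split=> //; exact: (patch_line uj).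
- move=> p q p1 q1 pq; apply: hausdorff_sep.
    by move=> _ [i _ <-]; exact: openT.
  have [pE p0] := line_pick p1; have [qE q0] := line_pick q1.
  set y := coefs _ in pE p0; set z := coefs _ in qE q0.
  pose f (w : 'rV[R]_n.+1) := dotp y w ^+ 2 / dotp w w.
  have fZ c w : c != 0 -> f (c *: w) = f w.
    move=> c0; rewrite /f !(dotpZr, dotpZl).
    have [->|w0] := eqVneq (dotp w w) 0; first by rewrite !mulr0 invr0 !mulr0.
    by field; rewrite w0 c0.
  exists (fun L => f (coefs (vpick L))).
    rewrite -/y -/z; apply/eqP => fyz; apply: pq.
    have : f z = dotp y y.
      by rewrite -fyz /f expr2 mulfK // dotp_eq0.
    move=> /(dotp_colinear p0) [c zc]; rewrite pE qE; apply/esym/lineP; exists c => //.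
    by apply: contra_neq q0 => c0; rewrite zc c0 scale0r.
  move=> _ [i _ <-] u _.
  rewrite (_ : _ \o _ = fun u => f (insert1 i u)).
    have C1 : Ck 0 setT (fun u => dotp y (insert1 i u)).
      apply: Ck_sum => [|k]; first exact: openT.
      apply: Ck_mul; [exact: openT|exact: Ck_cst|exact: Ck_insert1].
    have C2 : Ck 0 setT (fun u => dotp (insert1 i u) (insert1 i u)).
      apply: Ck_sum => [|k]; first exact: openT.
      apply: Ck_mul; [exact: openT|exact: Ck_insert1|exact: Ck_insert1].
    have C3 : Ck 0 setT (fun u => f (insert1 i u)).
      apply: (@Ck_mul _ _ _ _ (fun u => dotp y (insert1 i u) ^+ 2));
        first exact: openT.
        by apply: (Ck_mul _ C1 C1); exact: openT.
      apply: (Ck_inv _ _ C2) => [|v _]; first exact: openT.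
      by rewrite dotp_eq0 insert1_neq0.
    exact: (Ck_cont C3).
  apply/funext => v /=.
  by have [c c0 ->] := line_pickE (insert1_neq0 i v); rewrite fZ.
Qed.

Definition dual_proj n : manifold R n := Manifold (proj_atlas n).

Lemma open_neq_infinity n :
  atlas_open (atlas (dual_proj n)) [set L | L <> infinity n].
Proof.
move=> _ [i _ <-] /=.
have -> : [set u | line (insert1 i u) <> infinity n] =
    \bigcup_(j in [set j | j != ord_max])
      (setT `&` [set u : 'rV_n | insert1 i u ord0 j != 0]).
  apply/seteqP; split=> u /=.
    move=> H; apply: contrapT => K; apply: H; apply/lineP.
    have K' j : j != ord_max -> insert1 i u ord0 j = 0.
      move=> jm; apply/eqP; apply: contrapT => /negP uj.
      by apply: K; exists j.
    exists (insert1 i u ord0 ord_max).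
      apply/negP => /eqP um; have := insert1_neq0 i u; apply/negP; rewrite negbK.
      apply/eqP/rowP => j; rewrite [RHS]mxE.
      by have [->|/K'] := eqVneq j ord_max.
    apply/rowP => j; rewrite [RHS]mxE [X in _ = _ * X]mxE eqxx /=.
    by have [->|/K' ->] := eqVneq j ord_max; rewrite ?mulr1 ?mulr0.
  move=> [j jm [_ uj]] /lineP [c c0 E]; move: uj.
  by rewrite /= E mxE mxE (negPf jm) andbF mulr0 eqxx.
apply: openI; first exact: openT.
apply: bigcup_open => j _; apply: open_neq0; first exact: openT.
exact: (@Ck_cont _ _ 0 _ _ (@Ck_insert1 n i j 0 setT)).
Qed.

Definition dual_proj_minus n : manifold R n :=
  open_submanifold (@open_neq_infinity n).

End ProjectiveSpace.

Section Quotient.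
Context {R : realType}.

Definition sphere n : set 'rV[R]_n := [set v | \sum_i v ord0 i ^+ 2 = 1].

Definition eps : 'rV[R]_2 := const_mx 1.

Definition calT n : set 'rV[R]_(n + 2) :=
  [set z | exists2 v, sphere v & exists c, z = row_mx v (c *: eps)].

Definition sqnorm_off {n} (i : 'I_n) (u : 'rV[R]_n) : R :=
  \sum_(j | j != i) u ord0 j ^+ 2.

(** The hemisphere [(-1)^b v_i > 0] of the sphere is the graph of a function of
    the other coordinates of [v]; the coordinate [u_i], which is thus free, is
    used for [c]. *)
Definition calT_param {n} (ib : 'I_n * bool) : param R n 'rV[R]_(n + 2) :=
  Param [set u | sqnorm_off ib.1 u < 1]
    (fun u => row_mx
       (\row_j (if j == ib.1 then (-1) ^+ ib.2 * Num.sqrt (1 - sqnorm_off ib.1 u)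
                else u ord0 j))
       (u ord0 ib.1 *: eps)).

Definition antipodal {n} (z : 'rV[R]_n) : set 'rV[R]_n :=
  [set w | w = z \/ w = - z].

Lemma antipodalP n (z w : 'rV[R]_n) :
  antipodal z = antipodal w <-> z = w \/ z = - w.
Proof.
split=> [E|[->|->]] //.
  have : antipodal z z by left.
  by rewrite E.
by apply/seteqP; split=> v [->|->]; rewrite /antipodal /= ?opprK; [right|left|right|left].
Qed.

Lemma row_eps_inj n (v w : 'rV[R]_n) c e :
  row_mx v (c *: eps) = row_mx w (e *: eps) -> v = w /\ c = e.
Proof.
move=> /eq_row_mx [-> /rowP /(_ ord0)]; rewrite !mxE !mulr1; by [].
Qed.

Lemma scale_row_eps n (v : 'rV[R]_n) a c :
  a *: row_mx v (c *: eps) = row_mx (a *: v) ((a * c) *: eps).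
Proof. by rewrite scale_row_mx scalerA. Qed.

Lemma sign_sqr (b : bool) : ((-1) ^+ b) ^+ 2 = 1 :> R.
Proof. by rewrite sqrr_sign. Qed.

Lemma calT_param_in n (ib : 'I_n * bool) u : dom (calT_param ib) u ->
  calT (calT_param ib u).
Proof.
case: ib => i b /= du; eexists; last by exists (u ord0 i).
rewrite /sphere /= (bigD1 i) //= mxE eqxx exprMn sqrr_sign mul1r.
rewrite sqr_sqrtr; last by rewrite subr_ge0 ltW.
rewrite (eq_bigr (fun j => u ord0 j ^+ 2)) ?subrK // => j ji.
by rewrite mxE (negPf ji).
Qed.

(** A point of [calT] with nonzero [i]-th coordinate, up to sign, lies in both
    patches indexed by [i]. *)
Lemma calT_paramK n (i : 'I_n) (b : bool) (v : 'rV[R]_n) c :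
  sphere v -> v ord0 i != 0 ->
  let s := (-1) ^+ b * (Num.sqrt (v ord0 i ^+ 2) / v ord0 i) in
  let u := \row_k (if k == i then s * c else s * v ord0 k) in
  [/\ dom (calT_param (i, b)) u, s = 1 \/ s = -1 &
   calT_param (i, b) u = s *: row_mx v (c *: eps)].
Proof.
move=> sv vi s u.
have s1 : s = 1 \/ s = -1.
  rewrite /s sqrtr_sqr; have [v0|v0|v0] := ltgtP (v ord0 i) 0.
  - by rewrite ltr0_norm // mulNr divff //; case: b {s u}; rewrite ?expr1 ?expr0;
      [left|right]; rewrite ?mulrNN ?mul1r.
  - by rewrite gtr0_norm // divff //; case: b {s u}; rewrite ?expr1 ?expr0 mulr1;
      [right|left].
  - by rewrite v0 eqxx in vi.
have s2 : s ^+ 2 = 1 by case: s1 => ->; rewrite ?sqrrN expr1n.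
have q : sqnorm_off i u = 1 - v ord0 i ^+ 2.
  have : \sum_j v ord0 j ^+ 2 = 1 by [].
  rewrite (bigD1 i) //= => <-; rewrite addrAC subrr add0r.
  by apply: eq_bigr => j ji; rewrite mxE (negPf ji) exprMn s2 mul1r.
split=> //=.
  by rewrite q gtrBl exprn_even_gt0.
rewrite scale_row_eps; congr row_mx; last by rewrite mxE eqxx.
apply/rowP => j; rewrite !mxE; case: eqP => [->|_ //].
by rewrite q opprB addrC subrK /s -mulrA divfK.
Qed.

Lemma calT_patchP n (i : 'I_n) (b : bool) (v : 'rV[R]_n) c : sphere v ->
  (exists2 u, dom (calT_param (i, b)) u &
     antipodal (calT_param (i, b) u) = antipodal (row_mx v (c *: eps))) <->
  v ord0 i != 0.
Proof.
move=> sv; split=> [[u /= du /antipodalP E]|vi].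
  have q : 0 < Num.sqrt (1 - sqnorm_off i u) by rewrite sqrtr_gt0 subr_gt0.
  have E' a : row_mx (\row_j (if j == i then (-1) ^+ b * Num.sqrt (1 - sqnorm_off i u)
      else u ord0 j)) (u ord0 i *: eps) = a *: row_mx v (c *: eps) ->
      (-1) ^+ b * Num.sqrt (1 - sqnorm_off i u) = a * v ord0 i.
    rewrite scale_row_eps => /row_eps_inj [/rowP /(_ i)].
    by rewrite !mxE eqxx.
  have [a Ea] : exists a, (-1) ^+ b * Num.sqrt (1 - sqnorm_off i u) = a * v ord0 i.
    case: E => E; first by exists 1; apply: E'; rewrite scale1r.
    by exists (-1); apply: E'; rewrite scaleN1r.
  apply/eqP => v0; move/eqP: Ea; rewrite v0 mulr0 mulf_eq0 signr_eq0 /=.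
  by rewrite gt_eqF.
have [du s1 E] := calT_paramK b c sv vi.
eexists; first exact: du.
by apply/antipodalP; rewrite E; case: s1 => ->; rewrite ?scale1r ?scaleN1r;
  [left|right].
Qed.

Lemma calT_param_inj n (ib : 'I_n * bool) :
  {in dom (calT_param ib) &, injective (@antipodal (n + 2) \o calT_param ib)}.
Proof.
case: ib => i b u w; rewrite !inE /= => du dw /antipodalP E.
have qu : 0 < Num.sqrt (1 - sqnorm_off i u) by rewrite sqrtr_gt0 subr_gt0.
have qw : 0 < Num.sqrt (1 - sqnorm_off i w) by rewrite sqrtr_gt0 subr_gt0.
case: E => [/row_eps_inj [/rowP E c]|].
  apply/rowP => j; have := E j; rewrite !mxE.
  by case: eqP => [->|].
rewrite -[- row_mx _ _]scaleN1r scale_row_eps => /row_eps_inj [/rowP /(_ i)].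
rewrite !mxE eqxx mulrCA => /(mulfI (negbT (signr_eq0 R b))) H.
by exfalso; lra.
Qed.

Lemma Ck_sqnorm_off n (i : 'I_n) k (O : set 'rV[R]_n) : open O ->
  Ck k O (sqnorm_off i).
Proof.
move=> oO; apply: Ck_sum => // j; have C := Ck_coord k O j.
exact: (Ck_mul oO C C).
Qed.

Lemma open_calT_dom n (ib : 'I_n * bool) : open (dom (calT_param ib)).
Proof.
rewrite (_ : dom _ = setT `&` [set u | [set r | r < 1] (sqnorm_off ib.1 u)]).
  apply: open_pre; [exact: openT|exact: open_lt|].
  exact: (@Ck_cont _ _ 0 _ _ (Ck_sqnorm_off _ _ openT)).
by rewrite setTI.
Qed.

Lemma Ck_calT_param n (ib : 'I_n * bool) k l :
  Ck k (dom (calT_param ib)) (fun u => calT_param ib u ord0 l).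
Proof.
have oD := @open_calT_dom _ ib.
case: (splitP l) => [j lj|j lj].
  have -> : l = lshift 2 j by exact: val_inj.
  rewrite (_ : (fun u => _) = fun u => if j == ib.1
    then (-1) ^+ ib.2 * Num.sqrt (1 - sqnorm_off ib.1 u) else u ord0 j).
    case: eqP => _; last exact: Ck_coord.
    apply: Ck_mul => //; first exact: Ck_cst.
    apply: (@Ck_sqrt _ _ _ _ (fun u => 1 - sqnorm_off ib.1 u)) => //.
      by move=> u /=; rewrite subr_gt0.
    apply: Ck_add => //; first exact: Ck_cst.
    by apply: Ck_opp => //; exact: Ck_sqnorm_off.
  by apply/funext => u; rewrite /= row_mxEl mxE.
have -> : l = rshift n j by exact: val_inj.
rewrite (_ : (fun u => _) = fun u : 'rV_n => u ord0 ib.1); first exact: Ck_coord.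
by apply/funext => u; rewrite /= row_mxEr !mxE mulr1.
Qed.

Definition calT_atlas n : set (param R n 'rV[R]_(n + 2)) := range calT_param.

Lemma quotient_calT_atlas n : quotient_atlas antipodal (@calT_atlas n) =
  range (fun ib => Param (dom (calT_param ib)) (antipodal \o calT_param ib)).
Proof.
apply/seteqP; split=> [_ [_ [[ib _ <-] _] <-]|_ [ib _ <-]]; first by exists ib.
exists (calT_param ib) => //; split; first by exists ib.
exact: calT_param_inj.
Qed.

Lemma tcalT_atlas n : smooth_atlas (antipodal @` @calT n)
  (quotient_atlas antipodal (@calT_atlas n)).
Proof.
rewrite quotient_calT_atlas; split.
- exact/(sub_countable (card_image_le _ _))/countableP.
- by move=> _ [ib _ <-]; exact: open_calT_dom.
- move=> _ [ib _ <-] _ [u du <-]; exists (calT_param ib u) => //.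
  exact: calT_param_in.
- by move=> _ [ib _ <-]; exact: calT_param_inj.
- move=> _ [_ [v sv [c ->]] <-].
  have [i vi] : exists i, v ord0 i != 0.
    apply: contrapT => H; have := sv; rewrite /sphere /= big1 => [/esym/eqP|i _].
      by rewrite oner_eq0.
    have -> : v ord0 i = 0; last by rewrite expr0n.
    by apply/eqP; apply: contrapT => /negP vi; apply: H; exists i.
  have /(calT_patchP i false c sv) [u du E] := vi.
  by eexists; [exists (i, false)|exists u].
- move=> _ _ [[i b] _ <-] [[j b'] _ <-]; rewrite /smooth_in.
  set x := Param _ _; set y := Param _ _.
  pose D := dom (calT_param (i, b)).
  pose X u k := calT_param (i, b) u ord0 (lshift 2 k).
  pose c (u : 'rV[R]_n) := u ord0 i.
  have sX u : D u -> sphere (\row_k X u k).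
    move=> /calT_param_in [v sv [e E]].
    rewrite (_ : \row_k X u k = v) //; apply/rowP => k.
    by rewrite mxE /X E row_mxEl.
  have XE u : calT_param (i, b) u = row_mx (\row_k X u k) (c u *: eps).
    by rewrite /=; congr row_mx; apply/rowP => k; rewrite [RHS]mxE /X /= row_mxEl.
  have E u : D u -> patch y (x u) <-> X u j != 0.
    move=> Du; have := calT_patchP j b' (c u) (sX u Du); rewrite mxE => <-.
    by rewrite -XE.
  have -> : dom x `&` [set u | patch y (id (x u))] = D `&` [set u | X u j != 0].
    by apply/seteqP; split=> u [Du /= /(E _ Du) H]; split.
  have oD : open D := @open_calT_dom _ (i, b).
  have CX k l : Ck k D (X ^~ l) by exact: Ck_calT_param.
  have oO : open (D `&` [set u | X u j != 0]).
    by apply: open_neq0 => //; exact: (Ck_cont (CX 0%N j)).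
  split=> //.
  pose s u := (-1) ^+ b' * (Num.sqrt (X u j ^+ 2) / X u j).
  exists (fun u => \row_k (if k == j then s u * c u else s u * X u k)).
    apply: smooth_row => k l.
    have CXO m : Ck k (D `&` [set u | X u j != 0]) (X ^~ m).
      by apply: Ck_sub (CX k m); exact: subIsetl.
    have Cs : Ck k (D `&` [set u | X u j != 0]) s.
      apply: Ck_mul => //; first exact: Ck_cst.
      apply: Ck_mul => //.
        apply: (@Ck_sqrt _ _ _ _ (fun u => X u j ^+ 2)) => //.
          by move=> u [_ /= uj]; rewrite exprn_even_gt0.
        exact: (Ck_mul oO (CXO j) (CXO j)).
      by apply: (@Ck_inv _ _ _ _ (X ^~ j)) => // u [].
    by case: eqP => _; apply: Ck_mul => //; exact: Ck_coord.
  move=> u [Du uj]; have uj' : (\row_k X u k) ord0 j != 0 by rewrite mxE.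
  have [d1 s1 e1] := calT_paramK b' (c u) (sX u Du) uj'.
  have -> : \row_k (if k == j then s u * c u else s u * X u k) =
      \row_k (if k == j then
        (-1) ^+ b' * (Num.sqrt ((\row_k X u k) ord0 j ^+ 2) / (\row_k X u k) ord0 j)
          * c u
      else (-1) ^+ b' * (Num.sqrt ((\row_k X u k) ord0 j ^+ 2) /
        (\row_k X u k) ord0 j) * (\row_k X u k) ord0 k).
    by apply/rowP => k; rewrite !mxE.
  split; first exact: d1.
  transitivity (antipodal (calT_param (i, b) u)); last by [].
  rewrite [in RHS]XE; apply: (etrans (congr1 antipodal e1)); apply/antipodalP.
  by case: s1 => ->; rewrite ?scale1r ?scaleN1r; [left|right].
- move=> _ _ [z _ <-] [w _ <-] zw; apply: hausdorff_sep.
    by move=> _ [ib _ <-]; exact: open_calT_dom.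
  pose f (t : 'rV[R]_(n + 2)) := dotp (t - z) (t - z) * dotp (t + z) (t + z).
  have fN t : f (- t) = f t.
    rewrite /f -[- t - z]opprD -scaleN1r dotpZl dotpZr mulrA mulrNN !mul1r.
    rewrite mulrC; congr (_ * _).
    by rewrite -[- t + z]opprK opprD opprK -scaleN1r dotpZl dotpZr mulrA mulrNN !mul1r.
  have fE t : f (xget 0 (antipodal t)) = f t.
    by case: xgetP => [r _ [->|->]|/(_ t) []] //; left.
  exists (fun S => f (xget 0 S)).
    rewrite !fE {1}/f subrr (_ : dotp 0 0 = 0) ?mul0r; last first.
      by apply/eqP; rewrite dotp_eq0.
    rewrite eq_sym mulf_neq0 // dotp_eq0 ?subr_eq0 ?addr_eq0;
      by apply/eqP => wz; apply: zw; apply/antipodalP; rewrite wz ?opprK; auto.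
  move=> _ [ib _ <-] u du.
  rewrite (_ : _ \o _ = fun u => f (calT_param ib u)); last first.
    by apply/funext => v /=; rewrite fE.
  have oD := @open_calT_dom _ ib.
  have Cd (t : 'rV[R]_(n + 2)) : Ck 0 (dom (calT_param ib))
      (fun u => dotp (calT_param ib u + t) (calT_param ib u + t)).
    apply: Ck_sum => // k.
    have C : Ck 0 (dom (calT_param ib)) (fun u => (calT_param ib u + t) ord0 k).
      rewrite (_ : (fun u => _) = fun u => calT_param ib u ord0 k + t ord0 k).
        by apply: Ck_add => //; [exact: Ck_calT_param|exact: Ck_cst].
      by apply/funext => v; rewrite mxE.
    exact: (Ck_mul oD C C).
  exact: (Ck_cont (Ck_mul oD (Cd (- z)) (Cd z)) du).
Qed.

Definition tcalT n : manifold R n := Manifold (@tcalT_atlas n).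

Definition nu_vec {n} (y : 'rV[R]_n.+1) : 'rV[R]_(n + 2) :=
  let y' := (Num.sqrt (\sum_(i < n) y ord0 (widen_ord (leqnSn n) i) ^+ 2))^-1
              *: y in
  row_mx (\row_(i < n) y' ord0 (widen_ord (leqnSn n) i))
         ((- y' ord0 ord_max) *: eps).

(** Independent of the choice of a spanning form, see [tnuE]. *)
Definition tnu {n} (L : {vspace 'Hom('rV[R]_n.+1, R^o)}) : set 'rV[R]_(n + 2) :=
  antipodal (nu_vec (coefs (vpick L))).

Lemma tnuE n (y : 'rV[R]_n.+1) : y != 0 -> tnu (line y) = antipodal (nu_vec y).
Proof.
move=> y0; have [c c0 E] := line_pickE y0; rewrite /tnu E; apply/antipodalP.
have -> : nu_vec (c *: y) = (c / `|c|) *: nu_vec y.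
  rewrite /nu_vec scale_row_eps.
  rewrite (_ : \sum_(i < n) (c *: y) ord0 (widen_ord (leqnSn n) i) ^+ 2 =
    c ^+ 2 * \sum_(i < n) y ord0 (widen_ord (leqnSn n) i) ^+ 2); last first.
    by rewrite mulr_sumr; apply: eq_bigr => i _; rewrite mxE exprMn.
  rewrite sqrtrM ?sqr_ge0 // sqrtr_sqr invfM.
  congr row_mx; last by congr (_ *: _); rewrite !mxE; ring.
  by apply/rowP => i; rewrite !mxE; ring.
have [c1|c1|c1] := ltgtP c 0; last by rewrite c1 eqxx in c0.
  by right; rewrite ltr0_norm // invrN mulrN divff // scaleN1r.
by left; rewrite gtr0_norm // divff // scale1r.
Qed.

End Quotient.

(* Main.v *)
Require Import Defs.
From mathcomp Require Import all_boot all_order all_algebra.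
From mathcomp Require Import reals.
From mathcomp Require Import boolp classical_sets topology normedtype.
Set Implicit Arguments.
Unset Strict Implicit.
Unset Printing Implicit Defensive.
Import Order.TTheory GRing.Theory Num.Theory.
Import numFieldNormedType.Exports.

(** The inverse of [tnu] sends the class of [(v, c, c)] to the line spanned by
    [(v, -c)]: this is well defined because changing the sign of [(v, c, c)]
    does not change the line, and it is inverse to [tnu] because
    [nu_vec (v, -c) = (v, c, c)] for unit [v], whereas [nu_vec y] is sent to a
    positive multiple of [y].  In the charts both maps are composed of
    polynomials, quotients, and square roots of positive functions. *)

Section TnuInverse.
Local Open Scope classical_set_scope.
Local Open Scope ring_scope.
Context {R : realType}.

Local Notation widen := (widen_ord (leqnSn _)).

Definition sqnorm_init n (y : 'rV[R]_n.+1) : R :=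
  \sum_(i < n) y ord0 (widen i) ^+ 2.

(** On [calT] the last two coordinates are both [c], so reading the first of them suffices. The
    formula is linear in [t]; this is what makes the spanned line independent of the sign of [t]. *)
Definition nu_vec_inv n (t : 'rV[R]_(n + 2)) : 'rV[R]_n.+1 :=
  \row_j (if unlift ord_max j is Some k then t ord0 (lshift 2 k)
          else - t ord0 (rshift n ord0)).

(** [xget] chooses a representative; its default 0 never arises on an antipodal class, which is
    nonempty. *)
Definition tnu_inv n (S : set 'rV[R]_(n + 2)) : {vspace 'Hom('rV[R]_n.+1, R^o)} :=
  line (nu_vec_inv (xget 0 S)).

(** * Lines other than [infinity] *)

Lemma lift_max_widen n (i : 'I_n) : widen i = lift ord_max i.
Proof. by apply: ord_inj; rewrite lift_max. Qed.

Lemma sqnorm_init_gt0 n (y : 'rV[R]_n.+1) i :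
  y ord0 (widen i) != 0 -> 0 < sqnorm_init y.
Proof.
move=> yi; rewrite /sqnorm_init (bigD1 i) //= ltr_pwDl ?exprn_even_gt0 //.
by apply: sumr_ge0 => j _; exact: sqr_ge0.
Qed.

Lemma line_neq_infinityP n (y : 'rV[R]_n.+1) : y != 0 ->
  line y <> infinity n <-> exists i, y ord0 (widen i) != 0.
Proof.
move=> y0; split=> [yoo|[i yi] /lineP [c _ yE]]; last first.
  move: yi; rewrite yE !mxE lift_max_widen eqxx /= [_ == ord_max]eq_sym.
  by rewrite (negPf (neq_lift _ _)) mulr0 eqxx.
apply: contrapT => H; apply: yoo; apply/lineP.
have yw i : y ord0 (lift ord_max i) = 0.
  by apply/eqP/negPn/negP => yi; apply: H; exists i; rewrite lift_max_widen.
(* With all other coordinates zero, a zero last coordinate would force [y = 0]. *)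
exists (y ord0 ord_max).
  apply: contra_neq y0 => ym; apply/rowP => j; rewrite [RHS]mxE.
  by case: (unliftP ord_max j) => [k ->|->].
apply/rowP => j; rewrite !mxE eqxx /=.
case: (unliftP ord_max j) => [k ->|->]; last by rewrite eqxx mulr1.
by rewrite yw [_ == ord_max]eq_sym (negPf (neq_lift _ _)) mulr0.
Qed.

(** * Algebraic identities between [nu_vec] and [nu_vec_inv] *)

Lemma nu_vecE n (y : 'rV[R]_n.+1) : nu_vec y =
  (Num.sqrt (sqnorm_init y))^-1 *:
  row_mx (\row_i y ord0 (widen i)) ((- y ord0 ord_max) *: eps).
Proof.
rewrite scale_row_eps /nu_vec; congr row_mx; last by rewrite mxE mulrN.
by apply/rowP => i; rewrite !mxE.
Qed.

Lemma calT_nu_vec n (y : 'rV[R]_n.+1) : 0 < sqnorm_init y -> calT (nu_vec y).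
Proof.
move=> y0; rewrite nu_vecE scale_row_eps; eexists; last by eexists.
rewrite /sphere /=; under eq_bigr do rewrite !mxE exprMn.
by rewrite -mulr_sumr exprVn sqr_sqrtr ?ltW // mulVf // gt_eqF.
Qed.

Lemma nu_vec_invZ n a (t : 'rV[R]_(n + 2)) :
  nu_vec_inv (a *: t) = a *: nu_vec_inv t.
Proof.
by apply/rowP => j; rewrite !mxE; case: unlift => [k|]; rewrite ?mxE ?mulrN.
Qed.

Lemma nu_vec_inv_row n (v : 'rV[R]_n) c i :
  nu_vec_inv (row_mx v (c *: eps)) ord0 (widen i) = v ord0 i.
Proof. by rewrite mxE lift_max_widen liftK row_mxEl. Qed.

Lemma nu_vec_inv_row_max n (v : 'rV[R]_n) c :
  nu_vec_inv (row_mx v (c *: eps)) ord0 ord_max = - c.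
Proof. by rewrite mxE unlift_none row_mxEr !mxE mulr1. Qed.

(** The minus signs on the last coordinate in [nu_vec] and [nu_vec_inv] cancel, so only the
    normalization remains. *)
Lemma nu_vecK n (y : 'rV[R]_n.+1) :
  nu_vec_inv (nu_vec y) = (Num.sqrt (sqnorm_init y))^-1 *: y.
Proof.
rewrite nu_vecE nu_vec_invZ; congr (_ *: _); apply/rowP => j.
case: (unliftP ord_max j) => [k ->|->].
  by rewrite -lift_max_widen nu_vec_inv_row mxE.
by rewrite nu_vec_inv_row_max opprK.
Qed.

(** The first [n] coordinates already form a unit vector, so the normalizing factor is 1. *)
Lemma nu_vec_invK n (t : 'rV[R]_(n + 2)) : calT t -> nu_vec (nu_vec_inv t) = t.
Proof.
move=> [v sv [c ->]]; rewrite nu_vecE nu_vec_inv_row_max opprK.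
have -> : sqnorm_init (nu_vec_inv (row_mx v (c *: eps))) = 1.
  by rewrite -[RHS]sv; apply: eq_bigr => i _; rewrite nu_vec_inv_row.
rewrite sqrtr1 invr1 scale1r; congr row_mx; apply/rowP => i.
by rewrite mxE nu_vec_inv_row.
Qed.

Lemma sphere_neq0 n (v : 'rV[R]_n) : sphere v -> exists i, v ord0 i != 0.
Proof.
move=> sv; apply: contrapT => v0; move: sv; rewrite /sphere /= big1.
  by move/esym/eqP; rewrite oner_eq0.
move=> i _; apply/eqP; rewrite sqrf_eq0; apply/negPn/negP => vi.
by apply: v0; exists i.
Qed.

Lemma nu_vec_inv_finite n (t : 'rV[R]_(n + 2)) : calT t ->
  exists i, nu_vec_inv t ord0 (widen i) != 0.
Proof.
move=> [v /sphere_neq0 [i vi] [c ->]]; exists i.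
by rewrite nu_vec_inv_row.
Qed.

Lemma row_coord_neq0 n (y : 'rV[R]_n) i : y ord0 i != 0 -> y != 0.
Proof. by apply: contra_neq => ->; rewrite mxE. Qed.

(** The chosen representative is [t] or [- t], and by linearity both give proportional forms. *)
Lemma tnu_invE n (t : 'rV[R]_(n + 2)) :
  tnu_inv (antipodal t) = line (nu_vec_inv t).
Proof.
rewrite /tnu_inv; case: xgetP => [_ _ [->|->]|/(_ t) []] //; last by left.
apply/lineP; exists (-1); first by rewrite oppr_eq0 oner_neq0.
by rewrite -nu_vec_invZ scaleN1r.
Qed.

Lemma dual_proj_minusP n (L : {vspace 'Hom('rV[R]_n.+1, R^o)}) :
  carrier (dual_proj_minus n) L <->
  exists2 y, L = line y & exists i, y ord0 (widen i) != 0.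
Proof.
split=> [[/line_pick [LE y0] Loo]|[y -> [i yi]]].
  by eexists; first exact: LE; apply/(line_neq_infinityP y0); rewrite -LE.
have y0 := row_coord_neq0 yi.
by split; [apply/dim_line/eqP|apply/(line_neq_infinityP y0); exists i].
Qed.

(** * Smoothness in the charts *)

(** A map into the quotient is smooth as soon as it lifts, over the chart [x], to a smooth map [z]
    into [calT]. The chart [(j, b)] contains the class of [z u] exactly when the [j]-th coordinate
    is nonzero, and [calT_paramK] gives its chart coordinates in closed form. *)
Lemma smooth_in_antipodal d n P (x : param R d P) (f : P -> set 'rV[R]_(n + 2))
    (z : 'rV[R]_d -> 'rV[R]_(n + 2)) ib :
  open (dom x) -> (forall k l, Ck k (dom x) (fun u => z u ord0 l)) ->
  (forall u, dom x u -> calT (z u)) ->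
  (forall u, dom x u -> f (x u) = antipodal (z u)) ->
  smooth_in x (Param (dom (calT_param ib)) (antipodal \o calT_param ib)) f.
Proof.
case: ib => j b oD Cz Tz fE; set y := Param _ _.
pose v u := \row_k z u ord0 (lshift 2 k); pose c u := z u ord0 (rshift n ord0).
have zE u : dom x u -> sphere (v u) /\ z u = row_mx (v u) (c u *: eps).
  move=> /Tz [w sw [e E]].
  have -> : v u = w by apply/rowP => k; rewrite mxE E row_mxEl.
  by rewrite /c E row_mxEr !mxE mulr1.
have PE u : dom x u -> patch y (f (x u)) <-> v u ord0 j != 0.
  move=> Du; have [sv E] := zE u Du; rewrite (fE _ Du) E.
  exact: iff_trans (calT_patchP j b (c u) sv).
rewrite /smooth_in.
have -> : dom x `&` [set u | patch y (f (x u))] =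
    dom x `&` [set u | v u ord0 j != 0].
  by apply/seteqP; split=> u [Du /= /(PE _ Du)].
have Cv k l : Ck k (dom x) (fun u => v u ord0 l).
  by under eq_fun do rewrite mxE; exact: Cz.
have oO : open (dom x `&` [set u | v u ord0 j != 0]).
  by apply: open_neq0 => //; exact: (Ck_cont (Cv 0%N j)).
split=> //.
(* The sign for which [s u *: z u] lies on the hemisphere of [(j, b)]. It is written with a square
   root so that its smoothness where [v u ord0 j != 0] follows from the calculus lemmas. *)
pose s u := (-1) ^+ b * (Num.sqrt (v u ord0 j ^+ 2) / v u ord0 j).
exists (fun u => \row_k (if k == j then s u * c u else s u * v u ord0 k)).
  apply: smooth_row => k l.
  have CvO m : Ck k (dom x `&` [set u | v u ord0 j != 0]) (fun u => v u ord0 m).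
    by apply: Ck_sub (Cv k m); exact: subIsetl.
  have Cs : Ck k (dom x `&` [set u | v u ord0 j != 0]) s.
    apply: Ck_mul => //; first exact: Ck_cst.
    apply: Ck_mul => //.
      apply: (@Ck_sqrt _ _ _ _ (fun u => v u ord0 j ^+ 2)) => //.
        by move=> u [_ /= uj]; rewrite exprn_even_gt0.
      exact: (Ck_mul oO (CvO j) (CvO j)).
    by apply: (@Ck_inv _ _ _ _ (fun u => v u ord0 j)) => // u [].
  case: eqP => _; apply: Ck_mul => //.
  by apply: Ck_sub (Cz k _); exact: subIsetl.
move=> u [Du vj]; have [sv E] := zE u Du.
have [d1 s1 e1] := calT_paramK b (c u) sv vj.
split; first exact: d1.
(* The chart returns [s u *: z u], which has the same antipodal class as [z u]. *)
rewrite (fE _ Du) E; apply: (etrans (congr1 antipodal e1)); apply/antipodalP.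
by case: s1 => ->; rewrite ?scale1r ?scaleN1r; [left|right].
Qed.

(** The chart coordinates of [line (y u)] are the quotients by its [j]-th coordinate. As all these
    lines lie in [O], restricting the target chart to [O] leaves the domain unchanged. *)
Lemma smooth_in_line d n P (x : param R d P)
    (f : P -> {vspace 'Hom('rV[R]_n.+1, R^o)}) (y : 'rV[R]_d -> 'rV[R]_n.+1) j O :
  open (dom x) -> (forall k l, Ck k (dom x) (fun u => y u ord0 l)) ->
  (forall u, dom x u -> O (line (y u))) ->
  (forall u, dom x u -> f (x u) = line (y u)) ->
  smooth_in x (restrict O (proj_param j)) f.
Proof.
move=> oD Cy yO fE; rewrite /smooth_in.
have -> : dom x `&` [set u | patch (restrict O (proj_param j)) (f (x u))] =
    dom x `&` [set u | y u ord0 j != 0].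
  apply/seteqP; split=> u [Du]; rewrite /= (fE _ Du).
    by move=> [w [_ _] wE]; split=> //; apply/proj_patchP; exists w.
  move=> /proj_patchP [w _ wE]; split=> //; exists w => //; split=> //.
  by have := yO _ Du; rewrite -wE.
have oO : open (dom x `&` [set u | y u ord0 j != 0]).
  by apply: open_neq0 => //; exact: (Ck_cont (Cy 0%N j)).
split=> //.
exists (fun u => \row_k (y u ord0 (lift j k) / y u ord0 j)).
  apply: smooth_row => k l.
  have CyO m : Ck k (dom x `&` [set u | y u ord0 j != 0]) (fun u => y u ord0 m).
    by apply: Ck_sub (Cy k m); exact: subIsetl.
  apply: Ck_mul => //.
  by apply: (@Ck_inv _ _ _ _ (fun u => y u ord0 j)) => // u [].
move=> u [Du uj]; rewrite /= (patch_line uj) (fE _ Du).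
by split=> //; split=> //; exact: yO.
Qed.

Lemma Ck_nu_vec d n k (O : set 'rV[R]_d) (y : 'rV[R]_d -> 'rV[R]_n.+1) l :
  open O -> (forall j, Ck k O (fun u => y u ord0 j)) ->
  (forall u, O u -> 0 < sqnorm_init (y u)) ->
  Ck k O (fun u => nu_vec (y u) ord0 l).
Proof.
move=> oO Cy y0; under eq_fun do rewrite nu_vecE mxE.
apply: Ck_mul => //.
  apply: (@Ck_inv _ _ _ _ (fun u => Num.sqrt (sqnorm_init (y u)))) => //.
    by move=> u Ou; rewrite gt_eqF // sqrtr_gt0 y0.
  apply: (@Ck_sqrt _ _ _ _ (fun u => sqnorm_init (y u))) => //.
  apply: Ck_sum => // i; exact: (Ck_mul oO (Cy _) (Cy _)).
case: (splitP l) => [j lj|j lj].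
  have -> : l = lshift 2 j by exact: val_inj.
  by under eq_fun do rewrite row_mxEl mxE.
have -> : l = rshift n j by exact: val_inj.
under eq_fun do rewrite row_mxEr !mxE mulr1.
exact: Ck_opp.
Qed.

Lemma Ck_nu_vec_inv d n k (O : set 'rV[R]_d) (z : 'rV[R]_d -> 'rV[R]_(n + 2)) l :
  open O -> (forall j, Ck k O (fun u => z u ord0 j)) ->
  Ck k O (fun u => nu_vec_inv (z u) ord0 l).
Proof.
move=> oO Cz; under eq_fun do rewrite mxE.
by case: unlift => [j|]; [exact: Cz|exact: Ck_opp].
Qed.

Lemma smooth_tnu n : smooth_map (dual_proj_minus n) (tcalT n) (@tnu R n).
Proof.
split=> [_ /dual_proj_minusP [y -> [i yi]]|x y].
  rewrite tnuE ?(row_coord_neq0 yi) //; exists (nu_vec y) => //.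
  exact/calT_nu_vec/(sqnorm_init_gt0 yi).
move=> Ax; have oD := atlas_dom (manifold_atlas (dual_proj_minus n)) Ax.
move: Ax oD => [_ [i _ <-] <-] oD.
rewrite /atlas /= quotient_calT_atlas => -[ib _ <-].
(* Removing [infinity] from the chart keeps the radicand of the normalization positive, hence the
   square root and its inverse smooth. *)
have y0 u : dom (restrict [set L | L <> infinity n] (proj_param i)) u ->
    0 < sqnorm_init (insert1 i u).
  by move=> [_ /(line_neq_infinityP (insert1_neq0 i u)) [j /sqnorm_init_gt0]].
apply: (smooth_in_antipodal (z := fun u => nu_vec (insert1 i u))) => //.
- by move=> k l; apply: Ck_nu_vec => // j; exact: Ck_insert1.
- by move=> u /y0 /calT_nu_vec.
- by move=> u _; rewrite /= tnuE ?insert1_neq0.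
Qed.

Lemma smooth_tnu_inv n : smooth_map (tcalT n) (dual_proj_minus n) (@tnu_inv n).
Proof.
have fin (t : 'rV[R]_(n + 2)) : calT t ->
    carrier (dual_proj_minus n) (line (nu_vec_inv t)).
  by move=> /nu_vec_inv_finite tf; apply/dual_proj_minusP; exists (nu_vec_inv t).
split=> [_ [t Tt <-]|x y]; first by rewrite tnu_invE; exact: fin.
rewrite {1}/atlas /= quotient_calT_atlas => -[ib _ <-] [_ [j _ <-] <-].
apply: (smooth_in_line (y := fun u => nu_vec_inv (calT_param ib u))).
- exact: open_calT_dom.
- move=> k l; apply: Ck_nu_vec_inv; first exact: open_calT_dom.
  by move=> m; exact: Ck_calT_param.
- by move=> u /calT_param_in /fin [].
- by move=> u _; rewrite /= tnu_invE.
Qed.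

(** * The two maps are mutually inverse *)

Lemma tnuK n (L : {vspace 'Hom('rV[R]_n.+1, R^o)}) :
  carrier (dual_proj_minus n) L -> tnu_inv (tnu L) = L.
Proof.
move=> /dual_proj_minusP [y -> [i yi]].
rewrite tnuE ?(row_coord_neq0 yi) // tnu_invE nu_vecK; apply/lineP.
(* The factor is the inverse norm of the first [n] coefficients, nonzero because the line is not
   [infinity]. *)
eexists; last by [].
by rewrite invr_eq0 gt_eqF // sqrtr_gt0 (sqnorm_init_gt0 yi).
Qed.

Lemma tnu_invK n (S : set 'rV[R]_(n + 2)) :
  carrier (tcalT n) S -> tnu (tnu_inv S) = S.
Proof.
move=> [t Tt <-]; have [i ti] := nu_vec_inv_finite Tt.
by rewrite tnu_invE tnuE ?(row_coord_neq0 ti) // nu_vec_invK.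
Qed.

End TnuInverse.

Theorem lemma7p1 (R : realType) (n : nat) (n_gt0 : 0 < n) :
  diffeomorphism (dual_proj_minus n : manifold R n) (tcalT n : manifold R n) (@tnu R n).
Proof.
split; first exact: smooth_tnu.
exists (@tnu_inv R n); split; [exact: smooth_tnu_inv|exact: tnuK|exact: tnu_invK].
Qed.
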